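(* Let $\alpha>0$, let $\boldsymbol{X}$ be an $n\times p$ random data matrix with independent entries, $X_{ij}$ having density $g_{ij}$, and let $\boldsymbol{P},\boldsymbol{Q}$ be the permutation matrices corresponding to permutations $\pi_R$ of the row indices $\{1,\dots,n\}$ and $\pi_C$ of the column indices $\{1,\dots,p\}$ of $\boldsymbol{X}$. If $\boldsymbol{\theta}^g=(\lambda^g,\{u_i^g\}_{i=1}^n,\{v_j^g\}_{j=1}^p,(\sigma^g)^2)$ is a ''best'' fitting parameter for $\boldsymbol{X}$, then $\widetilde{\boldsymbol{\theta}}^g=(\lambda^g,\{u_{\pi_R(i)}^g\}_{i=1}^n,\{v_{\pi_C(j)}^g\}_{j=1}^p,(\sigma^g)^2)$ is a ''best'' fitting parameter for the permuted matrix $\boldsymbol{P}\boldsymbol{X}\boldsymbol{Q}^{\top}$.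
   Context: Convention: $\boldsymbol{P},\boldsymbol{Q}$ are such that the $(i,j)$ entry of $\boldsymbol{P}\boldsymbol{X}\boldsymbol{Q}^\top$ is $X_{\pi_R(i),\pi_C(j)}$. $f$ is a known probability density on $\mathbb{R}$ with $f(x)=f(-x)$, $M_f=\int f^{1+\alpha}$, and $$V_f(x;a,b,\sigma^2)=\sigma^{-\alpha}\Big[M_f-\Big(1+\frac1\alpha\Big)f^\alpha\Big(\Big|\frac{x-ab}{\sigma}\Big|\Big)\Big].$$ ''Best'' fitting parameter: let $\boldsymbol{X}$ be an $n\times p$ random matrix with independent entries, $X_{ij}$ having density $g_{ij}$. A tuple $\boldsymbol{\theta}^g=(\lambda^g,\{u_i^g\}_{i=1}^n,\{v_j^g\}_{j=1}^p,(\sigma^g)^2)$ (with $\lambda^g,u_i^g,v_j^g$ real and $\sigma^g>0$) is called a ''best'' fitting parameter for $\boldsymbol{X}$ if 1. $\sum_{i=1}^n(u_i^g)^2=1$ and $\sum_{j=1}^p(v_j^g)^2=1$; 2. for all $i,j$: $\lambda^gu_i^g=\arg\min_{a\in\mathbb{R}}\int V_f(x;a,v_j^g,(\sigma^g)^2)\,g_{ij}(x)\,dx$; 3. for all $i,j$: $\lambda^gv_j^g=\arg\min_{b\in\mathbb{R}}\int V_f(x;u_i^g,b,(\sigma^g)^2)\,g_{ij}(x)\,dx$; 4. for all $i,j$: $(\sigma^g)^2=\arg\min_{\sigma^2>0}\int V_f(x;\lambda^gu_i^g,v_j^g,\sigma^2)\,g_{ij}(x)\,dx=\arg\min_{\sigma^2>0}\int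 V_f(x;u_i^g,\lambda^gv_j^g,\sigma^2)\,g_{ij}(x)\,dx$. Here ''$=\arg\min$'' means that the left-hand side is a minimizer. *)

(* Defs.v *)
From HB Require Import structures.
From mathcomp Require Import all_boot all_order all_algebra all_fingroup.
From mathcomp Require Import all_classical all_reals all_analysis.

Set Implicit Arguments.
Unset Strict Implicit.
Unset Printing Implicit Defensive.

Import Order.TTheory GRing.Theory Num.Theory.
Import numFieldNormedType.Exports.

Local Open Scope classical_set_scope.
Local Open Scope ring_scope.

Section Densities.
Context {R : realType}.

Definition is_pdf (f : R -> R) : Prop :=
  [/\ measurable_fun [set: R] f,
      forall x, 0 <= f x
    & (\int[lebesgue_measure]_(x in [set: R]) (f x)%:E = 1)%E].

Context {d : measure_display} {T : measurableType d} (Pr : probability T R).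

Definition has_density (Y : T -> R) (g : R -> R) : Prop :=
  is_pdf g /\
  forall A : set R, measurable A ->
    (Pr (Y @^-1` A) = \int[lebesgue_measure]_(x in A) (g x)%:E)%E.

Definition mutually_independent (I : finType) (Y : I -> T -> R) : Prop :=
  forall (J : {set I}) (B : I -> set R), (forall k, measurable (B k)) ->
    Pr (\bigcap_(k in [set` J]) (Y k @^-1` B k)) =
    (\prod_(k in J) Pr (Y k @^-1` B k))%E.

Variables n p : nat.

Definition independent_with_densities (X : T -> 'M[R]_(n, p))
    (g : 'I_n -> 'I_p -> R -> R) : Prop :=
  [/\ forall i j, measurable_fun [set: T] (fun w => X w i j),
      mutually_independent (fun (k : 'I_n * 'I_p) w => X w k.1 k.2)
    & forall i j, has_density (fun w => X w i j) (g i j)].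

End Densities.

Section BestFit.
Context {R : realType} (f : R -> R) (alpha : R).

Definition Mf : \bar R :=
  (\int[lebesgue_measure]_(x in [set: R]) (f x `^ (1 + alpha))%:E)%E.

(* Extended-real valued because no finiteness of Mf is assumed.  The last
   argument is sigma^2, so sigma is recovered as its square root. *)
Definition Vf (x a b sigma2 : R) : \bar R :=
  (((Num.sqrt sigma2) `^ (- alpha))%:E *
   (Mf - ((1 + alpha^-1) *
          f `|(x - a * b) / Num.sqrt sigma2| `^ alpha)%:E))%E.

Definition expected_Vf (g : R -> R) (a b sigma2 : R) : \bar R :=
  (\int[lebesgue_measure]_(x in [set: R]) (Vf x a b sigma2 * (g x)%:E))%E.

Definition is_argmin (D : set R) (F : R -> \bar R) (t : R) : Prop :=
  D t /\ forall s, D s -> (F t <= F s)%E.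

Context {d : measure_display} {T : measurableType d} (Pr : probability T R).
Variables n p : nat.

(* A density is only determined almost everywhere; the integrals below do not
   depend on the version, so g may be any family of densities of X. *)
Definition best_fitting (X : T -> 'M[R]_(n, p))
    (lambda : R) (u : 'I_n -> R) (v : 'I_p -> R) (sigma : R) : Prop :=
  exists g : 'I_n -> 'I_p -> R -> R,
    independent_with_densities Pr X g /\
    [/\ 0 < sigma,
        \sum_i u i ^+ 2 = 1 /\ \sum_j v j ^+ 2 = 1,
        forall i j, is_argmin [set: R]
          (fun a => expected_Vf (g i j) a (v j) (sigma ^+ 2)) (lambda * u i),
        forall i j, is_argmin [set: R]
          (fun b => expected_Vf (g i j) (u i) b (sigma ^+ 2)) (lambda * v j)
      & forall i j,
          is_argmin [set s | 0 < s]
            (fun s => expected_Vf (g i j) (lambda * u i) (v j) s)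
            (sigma ^+ 2) /\
          is_argmin [set s | 0 < s]
            (fun s => expected_Vf (g i j) (u i) (lambda * v j) s)
            (sigma ^+ 2)].

End BestFit.

(* Main.v *)
Require Import Defs.
From HB Require Import structures.
From mathcomp Require Import all_boot all_order all_algebra all_fingroup.
From mathcomp Require Import all_classical all_reals all_analysis.

Set Implicit Arguments.
Unset Strict Implicit.
Unset Printing Implicit Defensive.

Import Order.TTheory GRing.Theory Num.Theory.
Import numFieldNormedType.Exports.

Local Open Scope classical_set_scope.
Local Open Scope ring_scope.

(** Being a best fitting parameter is a condition on each single entry
    [(i, j)] through [u i], [v j], the density [g i j] and the common [lambda]
    and [sigma], apart from the two normalizations, which are symmetric in the
    coordinates of [u] and of [v].
    By [perm_mx_mul_entry] the permuted matrix merely relabels the entries, so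
    its entry [(i, j)] has density [g (piR i) (piC j)], and the conditions at
    [(i, j)] for the permuted data are literally those at [(piR i, piC j)] for
    the original data.  The normalizations follow by reindexing the sums.

    What is left is that the relabelled entries still form a family with the
    required joint law; the only joint requirement is independence, and it is
    inherited by injective reindexing ([mutually_independent_comp]). *)

Lemma perm_mx_mul_entry (R : pzRingType) (n p : nat) (s : {perm 'I_n})
    (t : {perm 'I_p}) (M : 'M[R]_(n, p)) (i : 'I_n) (j : 'I_p) :
  (perm_mx s *m M *m (perm_mx t)^T) i j = M (s i) (t j).
Proof. by rewrite tr_perm_mx -row_permE -col_permE !mxE. Qed.

(** The product rule for [Y \o h] on [J] with events [B] is the product rule for
    [Y] on the image of [J] under [h], the event at [h k] being [B k]; this
    names one event for each index because [h] is injective. *)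
Lemma mutually_independent_comp (R : realType) (d : measure_display)
    (T : measurableType d) (Pr : probability T R) (I I' : finType)
    (Y : I -> T -> R) (h : I' -> I) (h_inj : injective h) :
  mutually_independent Pr Y -> mutually_independent Pr (fun k => Y (h k)).
Proof.
move=> indepY J B mB.
(* Off the range of h any measurable set would do as the event. *)
pose B' i := if [pick k | h k == i] is Some k then B k else setT.
have B'h k : B' (h k) = B k.
  rewrite /B'; case: pickP => [k' /eqP /h_inj -> //|/(_ k)].
  by rewrite eqxx.
have mB' i : measurable (B' i) by rewrite /B'; case: pickP.
have := indepY (h @: J)%SET B' mB'.
rewrite big_imset /=; last by move=> k k' _ _ /h_inj.
under eq_bigr => k _ do rewrite B'h.
move=> <-; congr (Pr _); apply/seteqP; split=> w Yw i /= iJ.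
  by case/imsetP: iJ => k kJ ->; rewrite B'h; exact: Yw.
by rewrite -B'h; apply: (Yw (h i)); exact: imset_f.
Qed.

Lemma independent_with_densities_perm (R : realType) (d : measure_display)
    (T : measurableType d) (Pr : probability T R) (n p : nat)
    (X : T -> 'M[R]_(n, p)) (g : 'I_n -> 'I_p -> R -> R)
    (s : {perm 'I_n}) (t : {perm 'I_p}) :
  independent_with_densities Pr X g ->
  independent_with_densities Pr
    (fun w => perm_mx s *m X w *m (perm_mx t)^T) (fun i j => g (s i) (t j)).
Proof.
case=> mX indepX densX.
have entryE i j : (fun w => (perm_mx s *m X w *m (perm_mx t)^T) i j) =
    (fun w => X w (s i) (t j)).
  by apply/funext => w; exact: perm_mx_mul_entry.
split=> [i j||i j]; try by rewrite entryE.
pose h (k : 'I_n * 'I_p) := (s k.1, t k.2).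
have h_inj : injective h by move=> [? ?] [? ?] [/perm_inj -> /perm_inj ->].
have := mutually_independent_comp h_inj indepX.
by congr mutually_independent; apply/funext => k; rewrite entryE.
Qed.

Theorem theorem3p5 (R : realType) (alpha : R) (halpha : 0 < alpha)
    (f : R -> R) (hf : is_pdf f) (hfsym : forall x, f x = f (- x))
    (d : measure_display) (T : measurableType d) (Pr : probability T R)
    (n p : nat) (X : T -> 'M[R]_(n, p)) (g : 'I_n -> 'I_p -> R -> R)
    (hX : independent_with_densities Pr X g)
    (piR : {perm 'I_n}) (piC : {perm 'I_p})
    (lambda : R) (u : 'I_n -> R) (v : 'I_p -> R) (sigma : R)
    (hbest : best_fitting f alpha Pr X lambda u v sigma) :
  best_fitting f alpha Pr
    (fun w => perm_mx piR *m X w *m (perm_mx piC)^T)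
    lambda (fun i => u (piR i)) (fun j => v (piC j)) sigma.
Proof.
case: hbest => g' [hX' [sigma_gt0 [u1 v1] argmin_a argmin_b argmin_s]].
exists (fun i j => g' (piR i) (piC j)).
split; first exact: independent_with_densities_perm.
split=> //; split.
- by rewrite -u1 [RHS](reindex_inj (@perm_inj _ piR)).
- by rewrite -v1 [RHS](reindex_inj (@perm_inj _ piC)).
Qed.
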